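(* Let $k\ge 1$ be an integer and let $\mathbf{w}\in\mathbb{R}^k$ be a vector with no entry equal to $0$. For a series of vectors $\mathbf{U}=\{\mathbf{u}_c\}_{c=1}^{n}$ with $\mathbf{u}_c\in\mathbb{R}^k$, define $$\mathrm{Orth}(\mathbf{U},\mathbf{w})=\prod_{c=1}^{n}\mathbf{H}(\mathbf{u}_c,\mathbf{w}),$$ where $\mathbf{H}(\mathbf{u},\mathbf{w})$ is the generalized Householder matrix. When $n=k$, the image of $\mathrm{Orth}$ (as a function of $\mathbf{U}$, for the given $\mathbf{w}$) is the set of all $k\times k$ generalized orthogonal matrices with respect to $\mathbf{w}$, i.e. $$\mathrm{Image}(\mathrm{Orth})=\mathbf{O}_{\mathbf{w}}(k).$$
   Context: For $\mathbf{w}\in\mathbb{R}^k$ with no zero entries, the quadratic inner product is $\langle \mathbf{x},\mathbf{y}\rangle_{\mathbf{w}}=\mathbf{x}^\top\mathrm{diag}(\mathbf{w})\mathbf{y}=\sum_{i=1}^k w_i x_i y_i$ for $\mathbf{x},\mathbf{y}\in\mathbb{R}^k$ (the $w_i$ may have mixed signs). A matrix $\mathbf{G}\in\mathbb{R}^{k\times k}$ is generalized orthogonal with respect to $\mathbf{w}$ if $\langle\mathbf{G}\mathbf{x},\mathbf{G}\mathbf{y}\rangle_{\mathbf{w}}=\langle\mathbf{x},\mathbf{y}\rangle_{\mathbf{w}}$ for all $\mathbf{x},\mathbf{y}$, equivalently $\mathbf{G}^\top\mathrm{diag}(\mathbf{w})\mathbf{G}=\mathrm{diag}(\mathbf{w})$;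 the set of all such matrices is the generalized orthogonal group $\mathbf{O}_{\mathbf{w}}(k)$. For a vector $\mathbf{u}\in\mathbb{R}^k$ (with $\mathbf{u}^\top\mathrm{diag}(\mathbf{w})\mathbf{u}\neq 0$, so that the quotient is defined), the generalized Householder matrix is $$\mathbf{H}(\mathbf{u},\mathbf{w})=\mathbf{I}-2\,\frac{\mathbf{u}\mathbf{u}^\top\mathrm{diag}(\mathbf{w})}{\mathbf{u}^\top\mathrm{diag}(\mathbf{w})\mathbf{u}},$$ where $\mathbf{I}$ is the $k\times k$ identity matrix; it describes the elementary reflection about the hyperplane with normal vector $\mathbf{u}$ in the space endowed with $\langle\cdot,\cdot\rangle_{\mathbf{w}}$.
   Formalization: H(u,w) is taken to be the identity when u^T diag(w) u = 0 (in particular for u = 0); with only non-isotropic u_c the claim fails, since a product of k reflections has determinant (-1)^k (for k = 1 the image is {-1}, not {1,-1}). *)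

(* Defs.v *)
From HB Require Import structures.
From mathcomp Require Import all_boot all_order all_algebra.
From mathcomp Require Import all_classical all_reals.
Set Implicit Arguments.
Unset Strict Implicit.
Unset Printing Implicit Defensive.
Import Order.TTheory GRing.Theory Num.Theory.
Local Open Scope classical_set_scope.
Local Open Scope ring_scope.

(* Vectors of R^k are columns; the weight vector w is a row because diag_mx
   takes a row. *)

Definition qinner (R : realType) (k : nat) (w : 'rV[R]_k) (x y : 'cV[R]_k) : R :=
  (x^T *m diag_mx w *m y) 0 0.

Definition gen_orthogonal (R : realType) (k : nat) (w : 'rV[R]_k)
    (G : 'M[R]_k) : Prop :=
  forall x y : 'cV[R]_k, qinner w (G *m x) (G *m y) = qinner w x y.

Definition gen_orthogonal_group (R : realType) (k : nat) (w : 'rV[R]_k) :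
    set 'M[R]_k :=
  [set G | gen_orthogonal w G].

(* When qinner w u u = 0 the division is 2 / 0 = 0, so the degenerate factor is
   the identity matrix. This convention is what makes a product of exactly k
   factors reach all of O_w(k): every genuine reflection has determinant -1, so
   k of them always multiply to determinant (-1)^k. *)
Definition gen_householder (R : realType) (k : nat) (u : 'cV[R]_k)
    (w : 'rV[R]_k) : 'M[R]_k :=
  1%:M - (2 / qinner w u u) *: (u *m u^T *m diag_mx w).

(* The ring product on 'M_k is mulmx, taken in increasing order of c. *)
Definition Orth (R : realType) (k n : nat) (U : 'I_n -> 'cV[R]_k)
    (w : 'rV[R]_k) : 'M[R]_k :=
  \prod_(c < n) gen_householder (U c) w.

(* Main.v *)
(* Sharp Cartan-Dieudonne theorem for a nondegenerate symmetric form [B] over a real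
   field, following Artin, by induction on the dimension [n].  If an isometry [G] fixes
   an anisotropic [x], restrict it to the orthogonal complement of [x].  If [x] and
   [G x - x] are anisotropic, the reflection along [G x - x] brings [G x] back to [x].
   Otherwise [N = G - 1] has totally isotropic image and kernel, which forces [N^2 = 0],
   [n = 2 rank N] and [det G > 0]; multiplying [G] by any reflection leaves this case,
   and parity of the determinant shows that the product so obtained has at most [n - 1]
   reflections.  Unused factors of [Orth] are filled with [u = 0], whose Householder
   matrix is the identity because [2 / 0 = 0]. *)
Require Import Defs.
From HB Require Import structures.
From mathcomp Require Import all_boot all_order all_algebra.
From mathcomp Require Import all_classical all_reals.
From mathcomp Require Import zify ring.
Set Implicit Arguments.
Unset Strict Implicit.
Unset Printing Implicit Defensive.
Import Order.TTheory GRing.Theory Num.Theory.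
Local Open Scope classical_set_scope.
Local Open Scope ring_scope.

(** * Symmetric bilinear forms, isometries and reflections over a field *)

Definition form (F : fieldType) n (B : 'M[F]_n) (x y : 'cV[F]_n) : F :=
  (x^T *m B *m y) 0 0.

Definition reflection (F : fieldType) n (B : 'M[F]_n) (u : 'cV[F]_n) : 'M[F]_n :=
  1%:M - (2 / form B u u) *: (u *m u^T *m B).

Definition isometry (F : fieldType) n (B G : 'M[F]_n) : Prop :=
  G^T *m B *m G = B.

Definition reflection_product (F : fieldType) n (B : 'M[F]_n) m (G : 'M[F]_n) : Prop :=
  exists s : seq 'cV[F]_n,
    [/\ all (fun u => form B u u != 0) s, (size s <= m)%N &
        G = \prod_(u <- s) reflection B u].

Section Form.
Variables (F : fieldType) (n : nat) (B : 'M[F]_n).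
Implicit Types (x y z u : 'cV[F]_n) (G P : 'M[F]_n).

Lemma formDl x y z : form B (x + y) z = form B x z + form B y z.
Proof. by rewrite /form linearD /= !mulmxDl mxE. Qed.

Lemma formDr x y z : form B x (y + z) = form B x y + form B x z.
Proof. by rewrite /form mulmxDr mxE. Qed.

Lemma formZl a x y : form B (a *: x) y = a * form B x y.
Proof. by rewrite /form linearZ /= -!scalemxAl mxE. Qed.

Lemma formZr a x y : form B x (a *: y) = a * form B x y.
Proof. by rewrite /form -!scalemxAr mxE. Qed.

Lemma formBl x y z : form B (x - y) z = form B x z - form B y z.
Proof. by rewrite -scaleN1r formDl formZl mulN1r. Qed.

Lemma formBr x y z : form B x (y - z) = form B x y - form B x z.
Proof. by rewrite -scaleN1r formDr formZr mulN1r. Qed.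

Lemma form0l x : form B 0 x = 0.
Proof. by rewrite -[0](scale0r 0) formZl mul0r. Qed.

Lemma formC x y : B^T = B -> form B x y = form B y x.
Proof.
move=> sB; rewrite /form.
have -> : y^T *m B *m x = (x^T *m B *m y)^T by rewrite !trmx_mul trmxK sB mulmxA.
by rewrite [RHS]mxE.
Qed.

(** [P] may be rectangular: its columns can span a proper subspace, with Gram matrix
    [P^T *m B *m P]. *)
Lemma form_congr m (P : 'M[F]_(n, m)) (x y : 'cV[F]_m) :
  form B (P *m x) (P *m y) = form (P^T *m B *m P) x y.
Proof. by rewrite /form trmx_mul !mulmxA. Qed.

Lemma form_inj (C : 'M[F]_n) : (forall x y, form B x y = form C x y) -> B = C.
Proof.
move=> e; apply/matrixP=> i j.
have h (A : 'M[F]_n) : form A (delta_mx i 0) (delta_mx j 0) = A i j.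
  by rewrite /form trmx_delta -rowE -colE !mxE.
by rewrite -!h.
Qed.

Lemma isometryP G :
  isometry B G <-> forall x y, form B (G *m x) (G *m y) = form B x y.
Proof.
split=> [h x y | h]; first by rewrite form_congr h.
by apply/esym/form_inj => x y; rewrite -form_congr h.
Qed.

Lemma isometryM G K : isometry B G -> isometry B K -> isometry B (G *m K).
Proof. by move=> /isometryP g /isometryP k; apply/isometryP=> x y; rewrite -!mulmxA g k. Qed.

Lemma isometry_unit G : B \in unitmx -> isometry B G -> G \in unitmx.
Proof. by move=> Bu h; move: Bu; rewrite -h unitmx_mul => /andP[]. Qed.

Lemma reflectionE u x :
  reflection B u *m x = x - (2 / form B u u * form B u x) *: u.
Proof.
rewrite /reflection mulmxBl mul1mx -scalemxAl -!mulmxA [u^T *m _]mx11_scalar.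
by rewrite mul_mx_scalar scalerA /form mulmxA.
Qed.

Lemma reflection_degenerate u : form B u u = 0 -> reflection B u = 1%:M.
Proof. by rewrite /reflection => ->; rewrite invr0 mulr0 scale0r subr0. Qed.

Lemma reflection_congr m (P : 'M[F]_(n, m)) (v : 'cV[F]_m) :
  reflection B (P *m v) *m P = P *m reflection (P^T *m B *m P) v.
Proof.
rewrite /reflection form_congr mulmxBl mulmxBr mul1mx mulmx1 -scalemxAl -scalemxAr.
by rewrite trmx_mul !mulmxA.
Qed.

(** Isotropic [u] are covered as well, since [Orth] ranges over arbitrary vectors. *)
Lemma reflection_isometry u : B^T = B -> isometry B (reflection B u).
Proof.
move=> sB; have [q0|q0] := eqVneq (form B u u) 0.
  by rewrite reflection_degenerate // /isometry trmx1 mulmx1 mul1mx.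
apply/isometryP=> x y; rewrite !reflectionE !(formBl, formBr, formZl, formZr).
by rewrite (formC x u sB); field.
Qed.

Lemma reflectionK u : form B u u != 0 -> reflection B u *m reflection B u = 1%:M.
Proof.
move=> q0; apply/matrixP=> i j.
suff h x : reflection B u *m (reflection B u *m x) = x.
  have := h (delta_mx j 0); rewrite mulmxA -colE => /matrixP /(_ i 0).
  by rewrite mxE => ->; rewrite !mxE eqxx andbT eq_sym.
rewrite !reflectionE !(formBr, formZr) -addrA -opprD -scalerDl.
rewrite [X in X *: u](_ : _ = 0) ?scale0r ?subr0 //; by field.
Qed.

(** Polarization: if the quadratic form vanishes, its value at [x + y] reduces to
    [2 * form B x y]. *)
Lemma isotropic_form0 : (2 : F) != 0 -> B^T = B -> (forall x, form B x x = 0) -> B = 0.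
Proof.
move=> n2 sB q0; apply: form_inj => x y.
have: 2 * form B x y = 0.
  have := q0 (x + y); rewrite formDl !formDr !q0 (formC y x sB) add0r addr0 => <-.
  by ring.
move/eqP; rewrite mulf_eq0 (negPf n2) => /eqP ->.
by rewrite /form mulmx0 mul0mx mxE.
Qed.

(** With [u = G *m x - x], invariance of the form gives [form B u u = 2 * form B u (G *m x)], so the
    reflection subtracts exactly [u] from [G *m x]. *)
Lemma isometry_fixed_reflection G x :
  B^T = B -> isometry B G -> form B (G *m x - x) (G *m x - x) != 0 ->
  reflection B (G *m x - x) *m (G *m x) = x.
Proof.
move=> sB /isometryP iG; set u := G *m x - x => q0; rewrite reflectionE.
have e : form B u u = 2 * form B u (G *m x).
  rewrite /u !(formBl, formBr) !iG (formC x _ sB); ring.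
have q1 : 2 * form B u (G *m x) != 0 by rewrite -e.
rewrite (_ : _ * _ = 1); first by rewrite scale1r opprB addrC subrK.
by rewrite e; field; rewrite andbC -negb_or -mulf_eq0.
Qed.

End Form.

(** * Orthogonal splitting along an anisotropic vector *)

(** The columns of [Y] are a basis of the hyperplane orthogonal to [u], which misses [u] because [u]
    is anisotropic. *)
Lemma orthogonal_complement (F : fieldType) n (B : 'M[F]_(1 + n)) (u : 'cV[F]_(1 + n)) :
  form B u u != 0 ->
  exists2 Y : 'M[F]_(1 + n, n), u^T *m B *m Y = 0 & row_mx u Y \in unitmx.
Proof.
move=> q0; set v := u^T *m B.
have vn0 : v != 0.
  by apply: contraNneq q0 => v0; rewrite /form -/v v0 mul0mx mxE.
have rk : \rank (kermx v^T) = n.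
  by rewrite mxrank_ker mxrank_tr rank_rV vn0 addnC addnK.
(* [row_base] has [\rank (kermx v^T)] rows; quantifying over [C] lets [rk] turn this dimension into
   [n] inside the type. *)
have [C [CK Cf]] : exists C : 'M[F]_(n, 1 + n), C *m v^T = 0 /\ row_free C.
  suff : exists C : 'M[F]_(\rank (kermx v^T), 1 + n), C *m v^T = 0 /\ row_free C.
    by rewrite rk.
  exists (row_base (kermx v^T)); split; last exact: row_base_free.
  by apply/sub_kermxP; rewrite eq_row_base.
exists C^T; first by apply: trmx_inj; rewrite trmx_mul trmxK CK trmx0.
rewrite -unitmx_tr tr_row_mx trmxK -row_free_unit.
apply: inj_row_free => z; rewrite -[z]hsubmxK mul_row_col => e.
(* Multiplying the relation by [v^T] kills the rows of [C] and leaves the coefficient of [u] times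
   [form B u u]. *)
have a0 : lsubmx z = 0.
  have := congr1 (mulmx^~ v^T) e; rewrite mulmxDl -[_ *m C *m _]mulmxA CK mulmx0 addr0 mul0mx -mulmxA.
  have -> : u^T *m v^T = (form B u u)%:M.
    by rewrite -trmx_mul [v *m u]mx11_scalar tr_scalar_mx.
  move/eqP; rewrite mul_mx_scalar scaler_eq0 (negPf q0).
  by move/eqP.
rewrite a0 mul0mx add0r in e.
have b0 : rsubmx z = 0.
  by apply: (row_free_inj Cf); rewrite e mul0mx.
by rewrite a0 b0 row_mx0.
Qed.

(** In the basis formed by [u] and its orthogonal hyperplane, the reflection is diagonal with
    entries -1, 1, ..., 1. *)
Lemma det_reflection (F : fieldType) n (B : 'M[F]_n) (u : 'cV[F]_n) :
  form B u u != 0 -> \det (reflection B u) = -1.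
Proof.
case: n B u => [|n] B u q0.
  by move: q0; rewrite /form [u]flatmx0 mulmx0 mxE eqxx.
have [Y uY Pu] := @orthogonal_complement F n B u q0.
have e : reflection B u *m row_mx u Y = row_mx u Y *m block_mx (-1)%:M 0 0 1%:M.
  rewrite mul_row_block !mulmx0 addr0 add0r mulmx1 mul_mx_row; congr row_mx.
    rewrite reflectionE mul_mx_scalar divfK // scaleN1r -[u in u - _]scale1r -scalerBl.
    by rewrite (_ : 1 - 2 = -1) ?scaleN1r //; ring.
  by rewrite /reflection mulmxBl mul1mx -scalemxAl -!mulmxA [u^T *m _]mulmxA uY mulmx0 scaler0 subr0.
have := congr1 (@determinant F (1 + n)) e; rewrite !(@det_mulmx _ (1 + n)) det_lblock det_scalar1 det1 mulr1 mulrC.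
by apply: mulfI; rewrite -unitfE -unitmxE.
Qed.

Lemma det_reflection_product (F : fieldType) n (B : 'M[F]_n) (s : seq 'cV[F]_n) :
  all (fun u => form B u u != 0) s ->
  \det (\prod_(u <- s) reflection B u) = (-1) ^+ size s.
Proof.
elim: s => [|u s IH] /=; first by rewrite big_nil det1.
by case/andP=> qu /IH e; rewrite big_cons det_mulmx e det_reflection // exprS.
Qed.

Lemma reflection_product_cons (F : fieldType) n (B : 'M[F]_n) m (G : 'M[F]_n) u :
  form B u u != 0 -> reflection_product B m (reflection B u *m G) ->
  reflection_product B m.+1 G.
Proof.
move=> q0 [s [qs ss e]]; exists (u :: s); split => //=; first by rewrite q0.
by rewrite big_cons -e /GRing.mul /= mulmxA reflectionK // mul1mx.
Qed.

(** In a basis made of [x] and its orthogonal hyperplane, [G] is block diagonal with blocks 1 and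
    [G']. The premise decomposes [G'], and each reflection of the hyperplane extends to the whole
    space by fixing [x]. *)
Lemma reflection_product_fixed (F : fieldType) n (B G : 'M[F]_(1 + n)) (x : 'cV[F]_(1 + n)) :
  (forall C K : 'M[F]_n, C^T = C -> C \in unitmx -> isometry C K ->
    reflection_product C n K) ->
  B^T = B -> B \in unitmx -> isometry B G -> form B x x != 0 -> G *m x = x ->
  reflection_product B n G.
Proof.
move=> IH sB uB iG qx Gx.
have [Y xY Pu] := orthogonal_complement qx.
set P := row_mx x Y in Pu.
have Yx : Y^T *m B *m x = 0.
  by apply: trmx_inj; rewrite !trmx_mul trmxK sB trmx0 mulmxA.
set B' := Y^T *m B *m Y; set q := form B x x.
have eC : P^T *m B *m P = block_mx q%:M 0 0 B'.
  by rewrite tr_row_mx mul_col_mx mul_col_row xY Yx -mx11_scalar.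
have sB' : B'^T = B' by rewrite !trmx_mul trmxK sB mulmxA.
have uB' : B' \in unitmx.
  have : P^T *m B *m P \in unitmx by rewrite !unitmx_mul unitmx_tr Pu uB.
  by rewrite eC block_diag_mx_unit => /andP[].
have [K PK] : exists K, P *m K = G *m P.
  by exists (invmx P *m (G *m P)); rewrite mulKVmx.
have iK : K^T *m (P^T *m B *m P) *m K = P^T *m B *m P.
  have -> : K^T *m (P^T *m B *m P) *m K = (P *m K)^T *m B *m (P *m K).
    by rewrite trmx_mul !mulmxA.
  by rewrite PK trmx_mul -[in RHS](iG : G^T *m B *m G = B) !mulmxA.
(* The first column of [K] is the first basis vector, because [P] sends that vector to [x] and [G]
   fixes [x]. *)
have [a [G' eK]] : exists a G', K = block_mx 1%:M a 0 G'.
  have c : lsubmx K = col_mx 1%:M 0.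
    have -> : lsubmx K = K *m col_mx 1%:M 0.
      by rewrite -[K in RHS]hsubmxK mul_row_col mulmx1 mulmx0 addr0.
    have Pe : P *m col_mx 1%:M 0 = x by rewrite mul_row_col mulmx1 mulmx0 addr0.
    by apply: (can_inj (mulKmx Pu)); rewrite mulmxA PK -mulmxA Pe Gx.
  exists (usubmx (rsubmx K)), (dsubmx (rsubmx K)).
  by rewrite -{1}[K]hsubmxK c block_mxEh vsubmxK.
move: iK; rewrite eC eK tr_block_mx !mulmx_block !trmx0 !trmx1.
rewrite !(mul0mx, mulmx0, mul1mx, mulmx1, addr0, add0r) => /eq_block_mx [_ ea _].
(* The upper right block of the isometry equation reads [q *: a = 0]. *)
have a0 : a = 0.
  by move/eqP: ea; rewrite mul_scalar_mx scaler_eq0 (negPf qx) => /eqP.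
rewrite a0 trmx0 !mul0mx add0r => iG'.
rewrite a0 in eK.
have [s [qs ss es]] := IH _ _ sB' uB' iG'.
have Pv v : P *m col_mx 0 v = Y *m v by rewrite mul_row_col mulmx0 add0r.
have qv v : form B (Y *m v) (Y *m v) = form B' v v by rewrite form_congr.
exists [seq Y *m v | v <- s]; split; rewrite ?size_map //.
  by rewrite all_map; apply: sub_all qs => v /=; rewrite qv.
(* Read in the basis [P], the reflection along [Y *m v] is the identity on [x] and the reflection
   along [v] on the hyperplane. *)
have e v : reflection B (Y *m v) *m P = P *m block_mx 1%:M 0 0 (reflection B' v).
  rewrite -Pv reflection_congr eC /reflection; congr (_ *m _).
  rewrite /form tr_col_mx trmx0 mul_row_block !mul0mx !mulmx0 !addr0 !add0r mul_row_col mul0mx add0r.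
  rewrite mul_col_row !mul0mx !mulmx0 mulmx_block !mul0mx !mulmx0 !addr0 !add0r.
  rewrite scale_block_mx !scaler0 (scalar_mx_block 1 n 1) opp_block_mx add_block_mx.
  by rewrite !oppr0 !addr0.
have GP : G *m P = (\prod_(u <- [seq Y *m v | v <- s]) reflection B u) *m P.
  rewrite -PK eK es; elim: (s) => [|v t IHt] /=.
    by rewrite !big_nil -(scalar_mx_block 1 n 1) mulmx1 mul1mx.
  rewrite !big_cons [in RHS]/GRing.mul /= -[RHS]mulmxA -IHt mulmxA e -mulmxA mulmx_block.
  by rewrite !mul0mx !mulmx0 !mul1mx !addr0 !add0r.
by rewrite -[LHS](mulmxK Pu) GP mulmxK.
Qed.

(** * Isotropic case and the Cartan-Dieudonne theorem over a real field *)

Section RealField.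
Variable F : realFieldType.

(* [form A (a t + x) (a t + x)] is a polynomial in [t] of degree exactly 2 when
   [a] is anisotropic, and the polynomial ring is a domain. *)
Lemma form_mul_eq0 n (A C : 'M[F]_n) (a : 'cV[F]_n) :
  (forall x, form A x x * form C x x = 0) -> form A a a != 0 ->
  forall x, form C x x = 0.
Proof.
move=> h qa x.
pose p (D : 'M[F]_n) : {poly F} :=
  (form D a a)%:P * 'X^2 + (form D a x + form D x a)%:P * 'X + (form D x x)%:P.
have pE D t : (p D).[t] = form D (t *: a + x) (t *: a + x).
  rewrite /p !(hornerD, hornerM, hornerXn, hornerC, hornerX).
  by rewrite !(formDl, formDr, formZl, formZr); ring.
have pq0 : p A * p C = 0.
  apply/eqP; apply/negPn/negP => pq.
  (* The product vanishes at every point, and in characteristic 0 the integers supply more distinct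
     roots than a nonzero polynomial of this size can have. *)
  set rs : seq F := [seq i%:R | i <- iota 0 (size (p A * p C)%R)].
  suff : (size rs < size (p A * p C)%R)%N by rewrite size_map size_iota ltnn.
  apply: max_poly_roots => //.
    by apply/allP => t _; rewrite /root hornerM !pE h.
  by rewrite map_inj_uniq ?iota_uniq //; apply: mulrIn; exact: oner_neq0.
have pA : p A != 0.
  apply: contraNneq qa => e; have := congr1 (fun r : {poly F} => r`_2) e.
  by rewrite /p !coefD !coefCM coefXn coefX coefC coef0 /= mulr1 mulr0 !addr0 => ->.
move/eqP: pq0; rewrite mulf_eq0 (negPf pA) /= => /eqP e.
by have := pE C 0; rewrite e horner0 scale0r add0r.
Qed.

Lemma exists_anisotropic n (B : 'M[F]_n.+1) :
  B^T = B -> B \in unitmx -> exists a, form B a a != 0.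
Proof.
move=> sB uB; apply: contrapT => no.
suff B0 : B = 0 by move: uB; rewrite B0 unitmxE det0 unitr0.
apply: isotropic_form0 => // [|x]; first by rewrite pnatr_eq0.
by apply/eqP; apply/negPn/negP => qx; apply: no; exists x.
Qed.

(** Put [N = G - 1%:M]. Expanding the isometry equation with [N^T *m B *m N = 0] leaves
    [N^T *m B = - (B *m N)], hence [B *m N *m N = 0]. *)
Lemma isometry_sqr0 n (B G : 'M[F]_n) :
  B \in unitmx -> isometry B G -> (G - 1%:M)^T *m B *m (G - 1%:M) = 0 ->
  (G - 1%:M) *m (G - 1%:M) = 0.
Proof.
move=> uB iG z; rewrite -[LHS](mulKmx uB) -[RHS](mulmx0 _ (invmx B)); congr (_ *m _).
have e : G - 1%:M + 1%:M = G by rewrite subrK.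
move: z e iG; move: (G - 1%:M) => N z <-.
rewrite /isometry [(_ + _)^T]linearD /= trmx1 !mulmxDl !mulmxDr z !mul1mx !mulmx1 add0r.
rewrite addrA -[RHS]add0r => /addIr /eqP; rewrite addr_eq0 => /eqP e.
by apply/eqP; rewrite mulmxA -oppr_eq0 -mulNmx -e z.
Qed.

(* [G] is unipotent of order 2, hence the square of [1 + N / 2] where [N = G - 1]. *)
Lemma isometry_det_gt0 n (B G : 'M[F]_n) :
  B \in unitmx -> isometry B G -> (G - 1%:M)^T *m B *m (G - 1%:M) = 0 ->
  0 < \det G.
Proof.
move=> uB iG z; have N2 := isometry_sqr0 uB iG z.
have : \det G != 0 by rewrite -unitfE -unitmxE (isometry_unit uB iG).
have e : G - 1%:M + 1%:M = G by rewrite subrK.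
rewrite lt0r => ->; move: N2 e; move: (G - 1%:M) => N N2 <-.
have -> : N + 1%:M = (1%:M + 2^-1 *: N) *m (1%:M + 2^-1 *: N).
  rewrite mulmxDl !mulmxDr !mul1mx mulmx1 -scalemxAl -scalemxAr N2 !scaler0 addr0 -addrA.
  by rewrite -scalerDl [X in X *: _](_ : _ = 1) ?scale1r 1?addrC //; field.
by rewrite det_mulmx -expr2 sqr_ge0.
Qed.

(** With [r] the rank of [N], [N *m N = 0] gives [2 r <= n], and total isotropy of the kernel, of
    dimension [n - r], gives [2 (n - r) <= n]; so [n = 2 r]. *)
Lemma isometry_even n (B G : 'M[F]_n) :
  B^T = B -> B \in unitmx -> isometry B G ->
  (G - 1%:M)^T *m B *m (G - 1%:M) = 0 ->
  (forall x, G *m x = x -> form B x x = 0) -> ~~ odd n.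
Proof.
move=> sB uB iG z fix0; have N2 := isometry_sqr0 uB iG z.
set N := G - 1%:M in N2.
(* The columns of [K^T] span the kernel of [N], that is, the fixed space of [G]. *)
have [K [rK NK]] : exists K : 'M_n, \rank K = (n - \rank N)%N /\ N *m K^T = 0.
  exists (kermx N^T); split; first by rewrite mxrank_ker mxrank_tr.
  by apply: trmx_inj; rewrite trmx_mul trmxK trmx0 mulmx_ker.
have KBK : K *m (B *m K^T) = 0.
  apply: isotropic_form0; first by rewrite pnatr_eq0.
    by rewrite !trmx_mul trmxK sB mulmxA.
  move=> y; rewrite mulmxA -{1}[K]trmxK -form_congr; apply: fix0.
  by apply/eqP; rewrite -subr_eq0 -{2}[_ *m y]mul1mx -mulmxBl mulmxA NK mul0mx.
have := mulmx0_rank_max KBK; have := mulmx0_rank_max N2.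
have -> : \rank (B *m K^T) = \rank K.
  by rewrite -mxrank_tr trmx_mul trmxK mxrankMfree // row_free_unit unitmx_tr.
have := rank_leq_row N; rewrite rK => r1 r2 r3.
have -> : n = (\rank N + \rank N)%N by lia.
by rewrite addnn odd_double.
Qed.

(** The induction hypothesis is a premise because the dichotomy is applied both to [G] and to
    [reflection B a *m G]. *)
Lemma reflection_product_or_isotropic n (B G : 'M[F]_n.+1) :
  (forall C K : 'M[F]_n, C^T = C -> C \in unitmx -> isometry C K ->
    reflection_product C n K) ->
  B^T = B -> B \in unitmx -> isometry B G ->
  reflection_product B n.+1 G \/
  ((G - 1%:M)^T *m B *m (G - 1%:M) = 0 /\ forall x, G *m x = x -> form B x x = 0).
Proof.
move=> IH sB uB iG.
have [[x [qx Gx]]|nofix] := pselect (exists x, form B x x != 0 /\ G *m x = x).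
  have [s [qs ss e]] := @reflection_product_fixed F n B G x IH sB uB iG qx Gx.
  by left; exists s; split=> //; apply: leqW.
have [[x [qx qu]]|nogood] := pselect (exists x, form B x x != 0 /\
    form B (G *m x - x) (G *m x - x) != 0).
  left; apply: (reflection_product_cons qu).
  apply: (@reflection_product_fixed F n B _ x) => //.
    by apply: isometryM => //; apply: reflection_isometry.
  by rewrite -mulmxA isometry_fixed_reflection.
right; split=> [|x Gx]; last first.
  by apply/eqP; apply/negPn/negP => qx; apply: nofix; exists x.
(* For every [x], either [x] or [G *m x - x] is isotropic, so a product of two quadratic forms
   vanishes identically. The first is nonzero at [a], so the second is zero, and polarization kills
   its matrix. *)
have [a qa] := exists_anisotropic sB uB.
apply: isotropic_form0; first by rewrite pnatr_eq0.
  by rewrite !trmx_mul trmxK sB mulmxA.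
apply: (form_mul_eq0 (A := B)) qa => x.
apply/eqP; rewrite mulf_eq0; apply/orP.
have [|qx] := eqVneq (form B x x) 0; first by left.
right; apply/negPn/negP; rewrite -form_congr mulmxBl mul1mx => qu.
by apply: nogood; exists x.
Qed.

Theorem cartan_dieudonne n (B G : 'M[F]_n) :
  B^T = B -> B \in unitmx -> isometry B G -> reflection_product B n G.
Proof.
elim: n B G => [|n IH] B G sB uB iG.
  by exists [::]; split=> //; rewrite big_nil [G]flatmx0 [RHS]flatmx0.
have [//|[z fix0]] := reflection_product_or_isotropic IH sB uB iG.
have [a qa] := exists_anisotropic sB uB.
have dG := isometry_det_gt0 uB iG z.
have iH : isometry B (reflection B a *m G).
  by apply: isometryM => //; apply: reflection_isometry.
have dH : \det (reflection B a *m G) < 0.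
  by rewrite det_mulmx det_reflection // mulN1r oppr_lt0.
have [[s [qs ss e]]|[z' _]] := reflection_product_or_isotropic IH sB uB iH; last first.
  by have := isometry_det_gt0 uB iH z'; rewrite ltNge (ltW dH).
apply: (reflection_product_cons qa); exists s; split=> //.
(* A length of exactly [n.+1], which is even here, would give determinant 1 against [dH]. Hence at
   most [n] reflections occur, leaving room for the one along [a]. *)
rewrite -ltnS ltn_neqAle ss andbT; apply/eqP => es.
move: dH; rewrite e det_reflection_product // es -signr_odd.
by rewrite (negPf (isometry_even sB uB iG z fix0)) expr0 ltr10.
Qed.

End RealField.

(** * Image of [Orth]: the form with matrix [diag_mx w] *)

Theorem theorem3p1 (R : realType) (k : nat) (w : 'rV[R]_k)
    (hk : (1 <= k)%N) (hw : forall i : 'I_k, w 0 i != 0) :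
  range (fun U : 'I_k -> 'cV[R]_k => Orth U w) = gen_orthogonal_group w.
Proof.
have sB : (diag_mx w)^T = diag_mx w by rewrite tr_diag_mx.
have uB : diag_mx w \in unitmx.
  by rewrite unitmxE det_diag unitfE; apply/prodf_neq0 => i _; apply: hw.
apply/seteqP; split=> [G /= [U _ <-]|G /= iG].
  apply/(isometryP (diag_mx w)); rewrite /Orth.
  apply: (big_ind (isometry (diag_mx w))).
  - by rewrite /isometry trmx1 mulmx1 mul1mx.
  - by move=> H K; apply: isometryM.
  - by move=> c _; apply: reflection_isometry.
have [s [_ ss ->]] := cartan_dieudonne sB uB (proj2 (isometryP (diag_mx w) G) iG).
(* The default value 0 of [nth] pads the list to length [k], and the factors past [size s] are then
   identities. *)
exists (fun c : 'I_k => nth 0 s c) => //; rewrite /Orth.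
rewrite (big_nth 0) big_mkord (big_ord_widen k (fun i => reflection (diag_mx w) s`_i) ss).
rewrite [RHS]big_mkcond /=; apply: eq_bigr => c _.
case: ltnP => // sc; rewrite nth_default //.
exact/(@reflection_degenerate R k (diag_mx w))/form0l.
Qed.
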